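(* Let $(\bar\theta,\bar z(\cdot))$ be a local optimal solution of the bilevel problem (BP) described in the context (hence also of problems (CP-1) and (CP-2)). (i) If (CP-2) is uniformly partially calm at $(\bar\theta,\bar z(\cdot))$ with $\bar\mu>0$, then (CP-1) is stochastically partially calm at $(\bar\theta,\bar z(\cdot))$ with $\mu(x)=\bar\mu$ for a.e. $x\in\mathcal X$. (ii) If (CP-1) is stochastically partially calm at $(\bar\theta,\bar z(\cdot))$ with a measurable function $\bar\mu:\mathcal X\to\mathbb R_+$, and $\bar\mu(\cdot)$ is essentially bounded, i.e. $\operatorname{ess\,sup}\bar\mu(\cdot):=\inf\{M\in\mathbb R:\ \bar\mu(x)\le M\text{ for a.e. }x\in\mathcal X\}<\infty$, then (CP-2) is uniformly partially calm at $(\bar\theta,\bar z(\cdot))$ with $\mu^b:=\operatorname{ess\,sup}\bar\mu(\cdot)$.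
   Context: Setting: $X,Y$ are random vectors with values in $\mathbb R^{d_x},\mathbb R^{d_y}$, support sets $\mathcal X,\mathcal Y$ and joint law $P$. $\Theta\subset\mathbb R^{d_\theta}$; $L:\mathbb R^{d_z}\times\mathbb R^{d_x}\times\mathbb R^{d_y}\times\mathbb R^{d_\theta}\to\mathbb R$ and $c:\mathbb R^{d_z}\times\mathbb R^{d_y}\to\mathbb R$ are continuous; $f_\theta(x)$ is a probability distribution of $Y$; $\mathfrak C(z,\theta,x):=\mathbb E_{f_\theta(x)}[c(z,Y)]$. Standing assumption: for any $(\theta,x)\in\Theta\times\mathcal X$, $\mathfrak C$ is continuously differentiable in $z$ (possibly nonconvex), and $\mathcal Z\subset\mathbb R^{d_z}$ is closed and convex. $\mathcal N_{\mathcal Z}(z)$ is the normal cone to $\mathcal Z$ at $z$. $\mathfrak C^*(\theta,x):=\min_{z\in\mathcal Z}\mathfrak C(z,\theta,x)$. $\mathfrak M$ is the set of measurable functions $z:\mathcal X\to\mathcal Z$. Local optimality is with respect to neighborhoods of $(\bar\theta,\bar z(\cdot))$ in $\Theta\times\mathfrak M$ (a fixed topology on this space, the same for all problems below). (BP): $\min_{\theta\in\Theta,z(\cdot)\in\mathfrak M}\mathbb E_P[L(z(X),X,Y,\theta)]$ s.t. $z(x)\in\arg\min_{z\in\mathcal Z}\mathfrak C(z,\theta,x)$ for a.e. $x\in\mathcal X$. (CP-1): $\min_{\theta\in\Theta,z(\cdot)\in\mathfrak M}\mathbb E_P[L(z(X),X,Y,\theta)]$ s.t. $0\in\nabla_z\mathfrak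 C(z(x),\theta,x)+\mathcal N_{\mathcal Z}(z(x))$ and $\mathfrak C(z(x),\theta,x)-\mathfrak C^*(\theta,x)\le0$ for a.e. $x\in\mathcal X$. (CP-2): the same as (CP-1) except that the last constraint is replaced by $\mathbb E[\mathfrak C(z(X),\theta,X)-\mathfrak C^*(\theta,X)]\le0$. (CP-2) is uniformly partially calm at $(\bar\theta,\bar z(\cdot))$ (with $\mu$) if there exists $\mu>0$ such that $(\bar\theta,\bar z(\cdot))$ is a local optimal solution of $$\min_{\theta\in\Theta,z(\cdot)\in\mathfrak M}\mathbb E_P[L(z(X),X,Y,\theta)]+\mu\,\mathbb E_P[\mathfrak C(z(X),\theta,X)-\mathfrak C^*(\theta,X)]\ \text{ s.t. }\ 0\in\nabla_z\mathfrak C(z(x),\theta,x)+\mathcal N_{\mathcal Z}(z(x))\text{ for a.e. }x\in\mathcal X.$$ (CP-1) is stochastically partially calm at $(\bar\theta,\bar z(\cdot))$ (with $\mu(\cdot)$) if there exists a measurable $\mu:\mathcal X\to\mathbb R_+$ such that $(\bar\theta,\bar z(\cdot))$ is a local optimal solution of $$\min_{\theta\in\Theta,z(\cdot)\in\mathfrak M}\mathbb E_P[L(z(X),X,Y,\theta)]+\mathbb E_P[\mu(X)(\mathfrak C(z(X),\theta,X)-\mathfrak C^*(\theta,X))]\ \text{ s.t. }\ 0\in\nabla_z\mathfrak C(z(x),\theta,x)+\mathcal N_{\mathcal Z}(z(x))\text{ for a.e. }x\in\mathcal X.$$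
   Formalization: In (ii), if μ^b = ess sup μ̄ = 0 (possible, e.g. L = c = 0, μ̄ = 0), calmness ''with μ^b > 0'' fails; the formal theorem gives local optimality of the penalized problem with μ^b ≥ 0 and, separately, uniform partial calmness with some μ > 0. *)

(* Defs.v *)
From HB Require Import structures.
From mathcomp Require Import all_boot all_order all_algebra.
From mathcomp Require Import all_classical all_reals all_analysis measurable_realfun.

Set Implicit Arguments.
Unset Strict Implicit.
Unset Printing Implicit Defensive.

Import Order.TTheory GRing.Theory Num.Theory.
Import numFieldNormedType.Exports.

Local Open Scope classical_set_scope.
Local Open Scope ring_scope.

(* 'rV[R]_n as a measurable type: R^n with its Borel sigma-algebra. *)
Notation borel_rV R n := (g_sigma_algebraType (@open 'rV[R]_n)).

Definition dotv (R : realType) (n : nat) (u v : 'rV[R]_n) : R :=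
  \sum_(i < n) u 0 i * v 0 i.

Definition gradient (R : realType) (n : nat) (g : 'rV[R]_n -> R)
    (z : 'rV[R]_n) : 'rV[R]_n :=
  \row_i 'D_(delta_mx 0 i) g z.

Definition continuously_differentiable (R : realType) (n : nat)
    (g : 'rV[R]_n -> R) : Prop :=
  (forall z, differentiable g z) /\ continuous (gradient g).

Definition convex_subset (R : realType) (n : nat) (A : set 'rV[R]_n) : Prop :=
  forall u v t, A u -> A v -> 0 <= t -> t <= 1 -> A (t *: u + (1 - t) *: v).

Definition normal_cone (R : realType) (n : nat) (A : set 'rV[R]_n)
    (z : 'rV[R]_n) : set 'rV[R]_n :=
  [set v | A z /\ forall y, A y -> dotv v (y - z) <= 0].

Definition argmin (R : realType) (T : Type) (A : set T) (g : T -> R) : set T :=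
  [set z | A z /\ forall y, A y -> g z <= g y].

(* The support of a law: the smallest closed set of full measure. *)
Definition is_support (R : realType) (n : nat)
    (mu : set (borel_rV R n) -> \bar R) (S : set 'rV[R]_n) : Prop :=
  [/\ closed S, mu S = 1%E
    & forall F : set 'rV[R]_n, closed F -> mu F = 1%E -> S `<=` F].

(* tau is the family of open sets of a topology on the set S. *)
Definition is_topology_on (T : Type) (S : set T) (tau : set (set T)) : Prop :=
  [/\ forall U, tau U -> U `<=` S,
      tau S,
      forall F : set (set T), F `<=` tau -> tau (\bigcup_(U in F) U)
    & forall U V, tau U -> tau V -> tau (U `&` V)].

Definition local_solution (R : realType) (T : Type) (tau : set (set T))
    (feasible : set T) (obj : T -> \bar R) (p : T) : Prop :=
  feasible p /\
  exists U, [/\ tau U, U p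
    & forall q, U q -> feasible q -> (obj p <= obj q)%E].

Record bilevel_data (R : realType) (dx dy dz dt : nat) := BilevelData {
  (* joint law of (X, Y) *)
  law : probability (borel_rV R dx * borel_rV R dy)%type R;
  suppX : set (borel_rV R dx);
  suppY : set (borel_rV R dy);
  Theta_set : set 'rV[R]_dt;
  Z_set : set 'rV[R]_dz;
  upper_cost : 'rV[R]_dz * 'rV[R]_dx * 'rV[R]_dy * 'rV[R]_dt -> R;
  lower_cost : 'rV[R]_dz * 'rV[R]_dy -> R;
  (* model theta x is the law f_theta(x) assigned to Y *)
  model : 'rV[R]_dt -> 'rV[R]_dx -> probability (borel_rV R dy) R
}.

Section bilevel.
Context (R : realType) (dx dy dz dt : nat) (D : bilevel_data R dx dy dz dt).

Definition lawX : set (borel_rV R dx) -> \bar R := pushforward (law D) fst.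
Definition lawY : set (borel_rV R dy) -> \bar R := pushforward (law D) snd.

Definition ae_X (Q : 'rV[R]_dx -> Prop) : Prop :=
  \forall x \ae lawX, suppX D x -> Q x.

(* Expectation under the joint law. Decision rules are only meaningful on
   suppX, hence the domain of integration, which has full measure. *)
Definition EP (h : 'rV[R]_dx -> 'rV[R]_dy -> \bar R) : \bar R :=
  (\int[law D]_(p in suppX D `*` suppY D) h p.1 p.2)%E.

Definition cost (z : 'rV[R]_dz) (theta : 'rV[R]_dt) (x : 'rV[R]_dx) : R :=
  \int[model D theta x]_y lower_cost D (z, y).

Definition standing_assumptions : Prop :=
  [/\ is_support lawX (suppX D) /\ is_support lawY (suppY D),
      continuous (upper_cost D) /\ continuous (lower_cost D),
      closed (Z_set D) /\ convex_subset (Z_set D),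
      (* the expectation defining the cost exists *)
      forall theta x, Theta_set D theta -> suppX D x ->
        forall z, (model D theta x).-integrable setT
          (fun y => (lower_cost D (z, y))%:E)
    & forall theta x, Theta_set D theta -> suppX D x ->
        continuously_differentiable (fun z => cost z theta x)].

(* An infimum in the extended reals: it is the minimum when that is attained,
   and attainment is not required. *)
Definition opt_cost (theta : 'rV[R]_dt) (x : 'rV[R]_dx) : \bar R :=
  ereal_inf [set (cost z theta x)%:E | z in Z_set D].

Definition gap (z : 'rV[R]_dz) (theta : 'rV[R]_dt) (x : 'rV[R]_dx) : \bar R :=
  ((cost z theta x)%:E - opt_cost theta x)%E.

(* Measurable maps from suppX to Z_set, represented by total functions whose
   values outside suppX are irrelevant. *)
Definition decision_rules : set ('rV[R]_dx -> 'rV[R]_dz) :=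
  [set z | measurable_fun (suppX D) (z : borel_rV R dx -> borel_rV R dz) /\
           forall x, suppX D x -> Z_set D (z x)].

Definition decision : Type := ('rV[R]_dt * ('rV[R]_dx -> 'rV[R]_dz))%type.

Definition admissible : set decision := Theta_set D `*` decision_rules.

Definition objective (p : decision) : \bar R :=
  EP (fun x y => (upper_cost D (p.2 x, x, y, p.1))%:E).

Definition expected_gap (p : decision) : \bar R :=
  EP (fun x _ => gap (p.2 x) p.1 x).

Definition measurable_gap : Prop :=
  forall p, admissible p ->
    measurable_fun (suppX D) (fun x : borel_rV R dx => gap (p.2 x) p.1 x).

Definition stationary (p : decision) : Prop :=
  ae_X (fun x =>
    [set gradient (fun z => cost z p.1 x) (p.2 x) + v
      | v in normal_cone (Z_set D) (p.2 x)] 0).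

Definition BP_feasible : set decision :=
  [set p | admissible p /\
    ae_X (fun x => argmin (Z_set D) (fun z => cost z p.1 x) (p.2 x))].

Definition CP1_feasible : set decision :=
  [set p | [/\ admissible p, stationary p
    & ae_X (fun x => (gap (p.2 x) p.1 x <= 0)%E)]].

Definition CP2_feasible : set decision :=
  [set p | [/\ admissible p, stationary p & (expected_gap p <= 0)%E]].

Definition penalized_feasible : set decision :=
  [set p | admissible p /\ stationary p].

Context (tau : set (set decision)).

Definition BP_local_solution (p : decision) : Prop :=
  local_solution tau BP_feasible objective p.

Definition CP1_local_solution (p : decision) : Prop :=
  local_solution tau CP1_feasible objective p.

Definition CP2_local_solution (p : decision) : Prop :=
  local_solution tau CP2_feasible objective p.

(* The positivity of mu is not part of this predicate, so that it also makes
   sense for mu = 0. *)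
Definition uniformly_partially_calm_with (mu : R) (p : decision) : Prop :=
  local_solution tau penalized_feasible
    (fun q => objective q + mu%:E * expected_gap q)%E p.

Definition uniformly_partially_calm (p : decision) : Prop :=
  exists mu, 0 < mu /\ uniformly_partially_calm_with mu p.

Definition penalty_function (mu : 'rV[R]_dx -> R) : Prop :=
  measurable_fun (suppX D) (mu : borel_rV R dx -> R) /\
  forall x, suppX D x -> 0 <= mu x.

Definition ess_sup_X (mu : 'rV[R]_dx -> R) : \bar R :=
  ereal_inf [set M%:E | M in [set M : R | ae_X (fun x => mu x <= M)]].

Definition stochastically_partially_calm_with (mu : 'rV[R]_dx -> R)
    (p : decision) : Prop :=
  penalty_function mu /\
  local_solution tau penalized_feasible
    (fun q => objective q + EP (fun x _ => (mu x)%:E * gap (q.2 x) q.1 x))%E p.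

Definition stochastically_partially_calm (p : decision) : Prop :=
  exists mu, stochastically_partially_calm_with mu p.

End bilevel.

Arguments decision : clear implicits.

(* Main.v *)
(* A minimizer of a differentiable function over a convex set is stationary,
   and a nonpositive optimality gap characterizes minimizers, so (BP), (CP-1)
   and (CP-2) have the same feasible points. A penalty function that is a.e.
   constant gives the same penalized objective as the constant. If mu <= M
   a.e., raising the penalty from mu to M only increases the objective, because
   the gap is nonnegative, and leaves it unchanged at a feasible point of (BP),
   where the gap vanishes; the essential supremum is itself such an M, by
   countable intersection, and M + 1 is a positive one. *)
Require Import Defs.
From HB Require Import structures.
From mathcomp Require Import all_boot all_order all_algebra.
From mathcomp Require Import all_classical all_reals all_analysis measurable_realfun.
Set Implicit Arguments.
Unset Strict Implicit.
Unset Printing Implicit Defensive.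
Import Order.TTheory GRing.Theory Num.Theory.
Import numFieldNormedType.Exports.
Local Open Scope classical_set_scope.
Local Open Scope ring_scope.

(* Outside (CP-2) the gap is not assumed measurable. The library's integral of
   a nonnegative function is a supremum over simple functions below it, which
   remains monotone a.e. and positively homogeneous without measurability. *)
Section lower_integral.
Import HBNNSimple.

(** Cut a simple function below [f] down to zero on a null set [N] containing every point where the
    comparison fails: the result lies below [g], and its integral is unchanged. *)
Lemma ge0_ae_le_lower_integral d (T : measurableType d) (R : realType)
    (mu : {measure set T -> \bar R}) (A : set T) (f g : T -> \bar R) :
  (forall x, A x -> 0 <= f x)%E -> (forall x, A x -> 0 <= g x)%E ->
  (\forall x \ae mu, A x -> (f x <= g x)%E) ->
  (\int[mu]_(x in A) f x <= \int[mu]_(x in A) g x)%E.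
Proof.
move=> f0 g0 [N [mN N0 fgN]].
rewrite !ge0_integralE//; apply: ge_ereal_sup => _ [h /= hf <-].
have mNC : measurable (~` N) by exact: measurableC.
apply: le_ereal_sup_tmp; exists (sintegral mu (proj_nnsfun h mNC)).
  exists (proj_nnsfun h mNC) => //= x.
  rewrite mindicE; have [Nx|] := boolP (x \in ~` N); last first.
    rewrite mulr0 => _; rewrite patchE; case: ifPn => // /set_mem; exact: g0.
  rewrite mulr1; apply: (le_trans (hf x)); rewrite !patchE.
  case: ifPn => // /set_mem Ax.
  apply: contrapT => fgx; move/set_mem: Nx; apply; apply: fgN => /=.
  by move=> /(_ Ax).
rewrite -!integralT_nnsfun le_eqVlt; apply/orP; left; apply/eqP.
apply: ge0_ae_eq_integral => //.
- exact/measurable_EFinP.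
- exact/measurable_EFinP.
- by move=> x _; rewrite lee_fin.
- by move=> x _; rewrite lee_fin.
exists N; split => // x /= /not_implyP[_]; apply: contra_notP => Nx.
by rewrite mindicE mem_set// mulr1.
Qed.

Lemma ge0_ae_eq_lower_integral d (T : measurableType d) (R : realType)
    (mu : {measure set T -> \bar R}) (A : set T) (f g : T -> \bar R) :
  (forall x, A x -> 0 <= f x)%E -> (forall x, A x -> 0 <= g x)%E ->
  ae_eq mu A f g ->
  (\int[mu]_(x in A) f x = \int[mu]_(x in A) g x)%E.
Proof.
move=> f0 g0 fg; apply/eqP; rewrite eq_le.
by rewrite !ge0_ae_le_lower_integral//; move: fg; apply: filterS => x + Ax => ->.
Qed.

(** Scaling simple functions by [c] gives one inequality for every [c > 0]; the reverse one is the
    same inequality for the factor [k^-1] and the function [k * f]. *)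
Lemma ge0_lower_integralZl d (T : measurableType d) (R : realType)
    (mu : {measure set T -> \bar R}) (A : set T) (f : T -> \bar R) (k : R) :
  (forall x, A x -> 0 <= f x)%E -> 0 <= k ->
  (\int[mu]_(x in A) (k%:E * f x) = k%:E * \int[mu]_(x in A) f x)%E.
Proof.
move=> f0; rewrite le_eqVlt => /predU1P[<-|k0].
  by rewrite mul0e integral0_eq// => x _; rewrite mul0e.
have le_scale (c : R) (h : T -> \bar R) : 0 < c -> (forall x, A x -> 0 <= h x)%E ->
    (c%:E * \int[mu]_(x in A) h x <= \int[mu]_(x in A) (c%:E * h x))%E.
  move=> c0 h0; rewrite muleC -lee_pdivlMr//.
  have ch0 x : A x -> (0 <= c%:E * h x)%E.
    by move=> Ax; rewrite mule_ge0 ?h0// lee_fin ltW.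
  rewrite !ge0_integralE//; apply: ge_ereal_sup => _ [s /= sh <-].
  rewrite lee_pdivlMr// muleC -sintegralrM.
  apply: le_ereal_sup_tmp; exists (sintegral mu (cst c \* s)) => //.
  exists (scale_nnsfun s (ltW c0)) => // x /=.
  have := sh x; rewrite !patchE EFinM; case: ifPn => // _ sx0.
    by rewrite lee_pmul2l.
  by rewrite mule_ge0_le0// lee_fin ltW.
apply/eqP; rewrite eq_le le_scale// andbT.
have kV : (k%:E * k^-1%:E = 1)%E by rewrite -EFinM mulfV// gt_eqF.
rewrite -[leLHS]mul1e -kV -muleA lee_pmul2l//.
apply: le_trans (le_scale _ _ _ _) _; rewrite ?invr_gt0//.
  by move=> x Ax; rewrite mule_ge0 ?f0// lee_fin ltW.
rewrite le_eqVlt; apply/orP; left; apply/eqP/eq_integral => x _.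
by rewrite muleA -EFinM mulVf ?mul1e// gt_eqF.
Qed.

End lower_integral.

(** * First-order optimality over a convex set *)

Lemma dotv_gradient (R : realType) (n : nat) (g : 'rV[R]_n -> R)
    (z v : 'rV[R]_n) :
  differentiable g z -> dotv (gradient g z) v = 'D_v g z.
Proof.
move=> dg; rewrite deriveE// [in RHS](row_sum_delta v) linear_sum.
by apply: eq_bigr => i _; rewrite mxE linearZ/= deriveE// mulrC.
Qed.

(** The derivative along [y - z] is a limit of right difference quotients. For [0 < h <= 1] the
    point [h *: (y - z) + z] stays in [A] by convexity, so each quotient is nonnegative. *)
Lemma argmin_normal_cone (R : realType) (n : nat) (A : set 'rV[R]_n)
    (g : 'rV[R]_n -> R) (z : 'rV[R]_n) :
  convex_subset A -> differentiable g z -> argmin A g z ->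
  normal_cone A z (- gradient g z).
Proof.
move=> convA dg [Az gz]; split=> // y Ay.
have -> : dotv (- gradient g z) (y - z) = - dotv (gradient g z) (y - z).
  by rewrite /dotv -sumrN; apply: eq_bigr => i _; rewrite mxE mulNr.
rewrite oppr_le0 dotv_gradient//.
have /cvg_dnbhs_at_right cvgD : h^-1 *: (g (h *: (y - z) + z) - g z) @[h --> 0^'] --> 'D_(y - z) g z.
  exact: diff_derivable.
rewrite -(cvg_lim _ cvgD)//; apply: limr_ge.
  by apply/cvg_ex; exists ('D_(y - z) g z).
near=> h.
have h0 : 0 < h by [].
apply: mulr_ge0; first by rewrite invr_ge0 ltW.
rewrite subr_ge0; apply: gz.
have -> : h *: (y - z) + z = h *: y + (1 - h) *: z.
  by rewrite scalerBr scalerBl scale1r addrA addrAC.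
by apply: convA => //; near: h; exact: nbhs_right_le.
Unshelve. all: by end_near. Qed.

(** * Almost-everywhere statements on the support, and expectations *)

Section bilevel_facts.
Context (R : realType) (dx dy dz dt : nat) (D : bilevel_data R dx dy dz dt).
Hypothesis hD : standing_assumptions D.

Lemma measurable_closed_rV (n : nat) (A : set 'rV[R]_n) :
  closed A -> measurable (A : set (borel_rV R n)).
Proof.
move=> cA; rewrite -[A]setCK; apply: measurableC.
by apply: sub_sigma_algebra; exact: closed_openC.
Qed.

Lemma measurable_suppX : measurable (suppX D).
Proof. by case: hD => [[[cX _ _] _] _ _ _ _]; exact: measurable_closed_rV. Qed.

Lemma measurable_suppY : measurable (suppY D).
Proof. by case: hD => [[_ [cY _ _]] _ _ _ _]; exact: measurable_closed_rV. Qed.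

(** [lawX] is typed as a bare set function; recovering its measure structure makes the filter lemmas
    on a.e. statements applicable. *)
Lemma lawX_is_measure :
  exists m : {measure set (borel_rV R dx) -> \bar R}, lawX D = m.
Proof.
unshelve eexists (pushforward (law D) fst : {measure set _ -> \bar R}) => //.
Qed.

Lemma ae_XS (Q1 Q2 : 'rV[R]_dx -> Prop) :
  (forall x, suppX D x -> Q1 x -> Q2 x) -> ae_X D Q1 -> ae_X D Q2.
Proof.
rewrite /ae_X; have [m ->] := lawX_is_measure => Q12; apply: filterS.
by move=> x q1 sx; apply: Q12 => //; exact: q1.
Qed.

Lemma ae_X_foralln (Q : nat -> 'rV[R]_dx -> Prop) :
  (forall n, ae_X D (Q n)) -> ae_X D (fun x => forall n, Q n x).
Proof.
rewrite /ae_X; have [m ->] := lawX_is_measure => /ae_foralln; apply: filterS.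
by move=> x Qx sx n; exact: Qx.
Qed.

(** Otherwise the support, which has mass 1, would lie in a null set. *)
Lemma ae_X_exists (Q : 'rV[R]_dx -> Prop) :
  ae_X D Q -> exists2 x, suppX D x & Q x.
Proof.
case: hD => [[[_ X1 _] _] _ _ _ _] [N [mN N0 QN]].
apply: contrapT => noQ.
have XN : suppX D `<=` N.
  by move=> x Xx; apply: QN => /= /(_ Xx) Qx; apply: noQ; exists x.
have [m lawm] := lawX_is_measure; move: X1 N0; rewrite lawm => X1 N0.
have : (m (suppX D) <= m N)%E.
  by apply: le_measure => //; rewrite inE; first exact: measurable_suppX.
by rewrite N0 [m _]X1 lee_fin leNgt ltr01.
Qed.

(** A null set for the law of X pulls back along [fst] to a null set for the joint law. *)
Lemma ae_X_law (Q : 'rV[R]_dx -> Prop) : ae_X D Q ->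
  \forall p \ae law D, (suppX D `*` suppY D) p -> Q p.1.
Proof.
case=> N [mN N0 QN]; exists (fst @^-1` N); split => //.
  by rewrite -[X in measurable X]setTI; exact: measurable_fst.
move=> [x y] /= /not_implyP[[/= Xx _] nQ]; apply: QN => /=.
by move=> /(_ Xx).
Qed.

Lemma le_EP (h k : 'rV[R]_dx -> \bar R) :
  (forall x, suppX D x -> 0 <= h x)%E -> (forall x, suppX D x -> 0 <= k x)%E ->
  ae_X D (fun x => h x <= k x)%E ->
  (EP D (fun x _ => h x) <= EP D (fun x _ => k x))%E.
Proof.
move=> h0 k0 hk; apply: ge0_ae_le_lower_integral.
- by move=> [x y] [Xx _]; exact: h0.
- by move=> [x y] [Xx _]; exact: k0.
- exact: (ae_X_law hk).
Qed.

Lemma eq_EP (h k : 'rV[R]_dx -> \bar R) :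
  (forall x, suppX D x -> 0 <= h x)%E -> (forall x, suppX D x -> 0 <= k x)%E ->
  ae_X D (fun x => h x = k x) ->
  EP D (fun x _ => h x) = EP D (fun x _ => k x).
Proof.
move=> h0 k0 hk; apply/eqP; rewrite eq_le.
by rewrite !le_EP//; apply: ae_XS hk => x _ ->.
Qed.

(** * The optimality gap and the feasible sets *)

Lemma opt_cost_le (z : 'rV[R]_dz) theta x :
  Z_set D z -> (opt_cost D theta x <= (cost D z theta x)%:E)%E.
Proof. by move=> Zz; apply: ereal_inf_lbound; exists z. Qed.

Lemma gap_ge0 (z : 'rV[R]_dz) theta x : Z_set D z -> (0 <= gap D z theta x)%E.
Proof. by move=> Zz; rewrite subre_ge0//; exact: opt_cost_le. Qed.

Lemma gap_le0_argmin (z : 'rV[R]_dz) theta x : Z_set D z ->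
  (gap D z theta x <= 0)%E <->
  argmin (Z_set D) (fun z => cost D z theta x) z.
Proof.
move=> Zz; rewrite /gap sube_le0; split.
  move=> le_opt; split=> // y Zy; rewrite -lee_fin.
  by apply: le_trans le_opt _; exact: opt_cost_le.
by move=> [_ zmin]; apply: le_ereal_inf_tmp => _ [y Zy <-]; rewrite lee_fin zmin.
Qed.

Lemma BP_feasible_gap (p : decision R dx dz dt) : admissible D p ->
  BP_feasible D p <-> ae_X D (fun x => gap D (p.2 x) p.1 x <= 0)%E.
Proof.
move=> ap; have [_ [_ Zp]] := ap; split.
  by move=> [_]; apply: ae_XS => x Xx /gap_le0_argmin; apply; exact: Zp.
by move=> g0; split=> //; apply: ae_XS g0 => x Xx /gap_le0_argmin; apply; exact: Zp.
Qed.

Lemma BP_feasible_stationary (p : decision R dx dz dt) :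
  BP_feasible D p -> stationary D p.
Proof.
case: hD => _ _ [_ convZ] _ C1 [[Tp _]].
apply: ae_XS => x Xx amin.
exists (- gradient (fun z => cost D z p.1 x) (p.2 x)); last by rewrite subrr.
apply: argmin_normal_cone => //.
by have [dC _] := C1 _ _ Tp Xx; exact: dC.
Qed.

Lemma BP_CP1_feasible : BP_feasible D = CP1_feasible D.
Proof.
apply/seteqP; split=> p.
  move=> fp; have ap := fp.1.
  by split=> //; [exact: BP_feasible_stationary|exact/BP_feasible_gap].
by move=> [ap _ g0]; exact/BP_feasible_gap.
Qed.

Lemma BP_feasible_EP_gap0 (p : decision R dx dz dt) (mu : 'rV[R]_dx -> R) :
  (forall x, suppX D x -> 0 <= mu x) -> BP_feasible D p ->
  EP D (fun x _ => (mu x)%:E * gap D (p.2 x) p.1 x)%E = 0%E.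
Proof.
move=> mu0 fp; have [[_ [_ Zp]] _] := fp.
have -> : 0%E = EP D (fun _ _ => 0%E) :> \bar R by rewrite /EP integral0.
apply: eq_EP => //.
  by move=> x Xx; rewrite mule_ge0 ?lee_fin ?mu0//; apply: gap_ge0; exact: Zp.
have /BP_feasible_gap := fp => /(_ fp.1); apply: ae_XS => x Xx g0.
suff -> : gap D (p.2 x) p.1 x = 0%E by rewrite mule0.
by apply/eqP; rewrite eq_le g0 gap_ge0//; exact: Zp.
Qed.

Lemma EP_cst_gap (p : decision R dx dz dt) (k : R) :
  0 <= k -> admissible D p ->
  EP D (fun x _ => k%:E * gap D (p.2 x) p.1 x)%E = (k%:E * expected_gap D p)%E.
Proof.
move=> k0 [_ [_ Zp]]; rewrite /expected_gap /EP ge0_lower_integralZl//.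
by move=> [x y] [Xx _]; apply: gap_ge0; exact: Zp.
Qed.

Lemma BP_feasible_expected_gap0 (p : decision R dx dz dt) :
  BP_feasible D p -> expected_gap D p = 0%E.
Proof.
move=> fp; rewrite -[LHS]mul1e -(EP_cst_gap ler01 fp.1).
exact: (BP_feasible_EP_gap0 (mu := cst 1)).
Qed.

(* Measurability is what makes a vanishing lower integral force the integrand
   to vanish almost everywhere. *)
Lemma expected_gap_le0 (p : decision R dx dz dt) :
  measurable_gap D -> admissible D p -> (expected_gap D p <= 0)%E ->
  ae_X D (fun x => gap D (p.2 x) p.1 x <= 0)%E.
Proof.
move=> mgap ap Eg0; have [_ [_ Zp]] := ap.
have mX := measurable_suppX; have mY := measurable_suppY.
set g := fun x : borel_rV R dx => gap D (p.2 x) p.1 x.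
have mg : measurable_fun (suppX D) g by exact: mgap.
have g0 x : suppX D x -> (0 <= g x)%E by move=> Xx; apply: gap_ge0; exact: Zp.
have mXY : measurable (suppX D `*` suppY D) by exact: measurableX.
have mgf : measurable_fun (suppX D `*` suppY D) (g \o fst).
  apply: (measurable_comp mX _ mg) => //; first by move=> _ [[x y] [Xx _] <-].
  exact: measurable_funS measurable_fst.
have : (\int[law D]_(q in suppX D `*` suppY D) `|(g \o fst) q| = 0)%E.
  rewrite (eq_integral (g \o fst)).
    apply/eqP; rewrite eq_le [X in X && _]Eg0; apply: integral_ge0.
    by move=> [x y] [Xx _]; exact: g0.
  by move=> [x y] /set_mem[Xx _]; rewrite gee0_abs//; exact: g0.
move/(ae_eq_integral_abs _ mXY mgf) => [N [mN N0 gN]].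
(* [B] is measurable, so its mass under the law of X is the joint mass of its preimage. *)
pose B := suppX D `&` [set x | g x != 0%E].
have mB : measurable B by exact: emeasurable_neq.
exists B; split => //; last first.
  move=> x /= /not_implyP[Xx ngx]; split => //=.
  by apply: contra_notN ngx => /eqP; rewrite /g => ->.
have mfB : measurable (fst @^-1` B : set (borel_rV R dx * borel_rV R dy)).
  by rewrite -[X in measurable X]setTI; exact: measurable_fst.
have mfY : measurable (snd @^-1` (~` suppY D) : set (borel_rV R dx * borel_rV R dy)).
  by rewrite -[X in measurable X]setTI; apply: measurable_snd => //; exact: measurableC.
apply/(negligibleP _ mfB).
(* Over [B], points with second coordinate in [suppY D] lie in [N]; the others lie in a strip that
   is null because [suppY D] has mass 1. *)
apply: (@negligibleS _ _ _ _ (N `|` snd @^-1` (~` suppY D))).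
  move=> [x y] [/= Xx gx0]; have [Yy|] := pselect (suppY D y); last by right.
  left; apply: gN => /= /(_ (conj Xx Yy)) gx; by rewrite gx eqxx in gx0.
apply: negligibleU; first exact/negligibleP.
apply/negligibleP => //.
have mfY' : measurable (snd @^-1` suppY D : set (borel_rV R dx * borel_rV R dy)).
  by rewrite -[X in measurable X]setTI; exact: measurable_snd.
case: hD => [[_ [_ Y1 _]] _ _ _ _].
have -> : snd @^-1` (~` suppY D) = ~` (snd @^-1` suppY D) by [].
transitivity (1 - law D (snd @^-1` suppY D))%E; first exact: probability_setC.
by move: Y1; rewrite /lawY /pushforward => ->; rewrite subee.
Qed.

(** * The essential supremum as an a.e. bound *)

Lemma ess_sup_X_attained (mu : 'rV[R]_dx -> R) :
  (forall x, suppX D x -> 0 <= mu x) -> (ess_sup_X D mu < +oo)%E ->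
  0 <= fine (ess_sup_X D mu) /\
  ae_X D (fun x => mu x <= fine (ess_sup_X D mu)).
Proof.
move=> mu0 essoo.
(* Each a.e. bound [M] holds at some point of the support, where [mu] is nonnegative. *)
have ess0 : (0 <= ess_sup_X D mu)%E.
  apply: le_ereal_inf_tmp => _ [M muM <-]; rewrite lee_fin.
  by have [x Xx] := ae_X_exists muM; apply: le_trans (mu0 x Xx).
have fess : ess_sup_X D mu \is a fin_num by rewrite ge0_fin_numE.
split; first exact: fine_ge0.
(* By definition of the infimum, some a.e. bound lies below the essential supremum plus
   [n.+1%:R^-1]; the countably many exceptional null sets are then merged. *)
apply: (@ae_XS (fun x => forall n, mu x <= fine (ess_sup_X D mu) + n.+1%:R^-1)).
  move=> x _ mux; apply/ler_addgt0Pr => e e0.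
  have [n _ /(_ n (leqnn n)) /= ne] := near_infty_natSinv_lt (PosNum e0).
  by apply: le_trans (mux n) _; rewrite lerD2l ltW.
apply: ae_X_foralln => n.
have n0 : 0 < n.+1%:R^-1 :> R by rewrite invr_gt0.
have [_ [M muM <-] Mlt] := lb_ereal_inf_adherent n0 fess.
apply: ae_XS muM => x _ /le_trans; apply.
by rewrite -lee_fin EFinD fineK// ltW.
Qed.

End bilevel_facts.

Theorem proposition4p2 (R : realType) (dx dy dz dt : nat)
    (D : bilevel_data R dx dy dz dt)
    (tau : set (set (decision R dx dz dt)))
    (thetabar : 'rV[R]_dt) (zbar : 'rV[R]_dx -> 'rV[R]_dz) :
  standing_assumptions D ->
  is_topology_on (admissible D) tau ->
  BP_local_solution D tau (thetabar, zbar) ->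
  [/\ CP1_local_solution D tau (thetabar, zbar),
      measurable_gap D ->
        CP2_local_solution D tau (thetabar, zbar),
      (forall mubar : R, 0 < mubar ->
         uniformly_partially_calm_with D tau mubar (thetabar, zbar) ->
         stochastically_partially_calm D tau (thetabar, zbar) /\
         forall mu : 'rV[R]_dx -> R, penalty_function D mu ->
           ae_X D (fun x => mu x = mubar) ->
           stochastically_partially_calm_with D tau mu (thetabar, zbar))
    & (forall mubar : 'rV[R]_dx -> R,
         stochastically_partially_calm_with D tau mubar (thetabar, zbar) ->
         (ess_sup_X D mubar < +oo)%E ->
         uniformly_partially_calm D tau (thetabar, zbar) /\
         uniformly_partially_calm_with D tau
           (fine (ess_sup_X D mubar)) (thetabar, zbar))].
Proof.
move=> hD _ BPsol; have BPbar := BPsol.1.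
split.
- by rewrite /CP1_local_solution -BP_CP1_feasible.
- move=> mgap; have [_ [U [tU Ubar Umin]]] := BPsol.
  split.
    split; [exact: BPbar.1|exact: BP_feasible_stationary|].
    by rewrite BP_feasible_expected_gap0.
  (* The neighborhood from (BP) serves again: measurability of the gap turns [Eq0] into feasibility
     of [q] for (BP). *)
  exists U; split=> // q Uq [aq _ Eq0]; apply: Umin => //.
  by apply/BP_feasible_gap => //; exact: expected_gap_le0.
- move=> mubar mubar0 [pen [U [tU Ubar Umin]]].
  (* Stated for every admissible [mu], so that the constant function can serve as the witness of
     stochastic calmness. *)
  have calm mu : penalty_function D mu -> ae_X D (fun x => mu x = mubar) ->
      stochastically_partially_calm_with D tau mu (thetabar, zbar).
    move=> pmu muE; split; first exact: pmu.
    split; first exact: pen.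
    exists U; split; [exact: tU|exact: Ubar|move=> q Uq fq].
    have EPE p : admissible D p ->
        EP D (fun x _ => (mu x)%:E * gap D (p.2 x) p.1 x)%E =
        (mubar%:E * expected_gap D p)%E.
      move=> ap; have [_ [_ Zp]] := ap.
      rewrite -(EP_cst_gap (ltW mubar0) ap); apply: eq_EP => //.
      + move=> x Xx; rewrite mule_ge0 ?lee_fin ?pmu.2//.
        by apply: gap_ge0 => //; exact: Zp.
      + move=> x Xx; rewrite mule_ge0 ?lee_fin ?(ltW mubar0)//.
        by apply: gap_ge0 => //; exact: Zp.
      + by apply: ae_XS muE => // x _ ->.
    by rewrite (EPE _ BPbar.1) (EPE _ fq.1); exact: Umin.
  split; last exact: calm.
  exists (cst mubar); apply: calm.
    by split=> [|x _]; [exact: measurable_cst|exact: ltW].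
  by rewrite /ae_X; have [m ->] := lawX_is_measure D; exact: aeW.
- move=> mubar [[_ mubar0] [pen [U [tU Ubar Umin]]]] essoo.
  (* Stated for any a.e. bound [M], to be used at the essential supremum and at a strictly positive
     bound. *)
  have calm M : 0 <= M -> ae_X D (fun x => mubar x <= M) ->
      uniformly_partially_calm_with D tau M (thetabar, zbar).
    move=> M0 muM; split; first exact: pen.
    exists U; split; [exact: tU|exact: Ubar|move=> q Uq fq].
    (* Both penalties vanish at the reference point, so its value can be rewritten with the penalty
       [mubar] and compared with [q] by [Umin]. *)
    rewrite (BP_feasible_expected_gap0 BPbar) mule0.
    rewrite -(BP_feasible_EP_gap0 mubar0 BPbar).
    apply: le_trans (Umin q Uq fq) _.
    have [_ [_ Zq]] := fq.1.
    apply: leeD2l; rewrite -(EP_cst_gap M0 fq.1); apply: le_EP => //.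
    + move=> x Xx; rewrite mule_ge0 ?lee_fin ?mubar0//.
      by apply: gap_ge0 => //; exact: Zq.
    + move=> x Xx; rewrite mule_ge0 ?lee_fin//.
      by apply: gap_ge0 => //; exact: Zq.
    + apply: ae_XS muM => // x Xx muxM; apply: lee_wpmul2r; rewrite ?lee_fin//.
      by apply: gap_ge0 => //; exact: Zq.
  have [ess0 muess] := ess_sup_X_attained hD mubar0 essoo.
  split; last exact: calm.
  (* The essential supremum may be 0, while uniform calmness asks for a positive constant. *)
  exists (fine (ess_sup_X D mubar) + 1); split; first by rewrite ltr_wpDl.
  apply: calm; first by rewrite addr_ge0.
  by apply: ae_XS muess => // x _ /le_trans; apply; rewrite lerDl.
Qed.
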